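(* Let $G$ be a connected graph. Then $G$ is a vertex-stable equimatchable graph if and only if $G$ is a complete graph, or a complete bipartite graph, or a bipartite edge-stable equimatchable graph.
   Context: All graphs are finite and simple. A graph is equimatchable if all its maximal matchings have the same cardinality. A graph $G$ is vertex-stable equimatchable if $G$ is equimatchable and $G-v$ is equimatchable for every $v\in V(G)$. An equimatchable graph $G$ is edge-stable if $G\setminus e$ (delete edge $e$, keep vertices) is equimatchable for every $e\in E(G)$. *)

(* Defs.v *)
From mathcomp Require Import all_boot.
Set Implicit Arguments. Unset Strict Implicit. Unset Printing Implicit Defensive.

Section Graphs.
Variable T : finType.

Definition is_graph (V : {set T}) (E : {set {set T}}) : Prop :=
  forall f, f \in E -> f \subset V /\ #|f| = 2.

Definition adj (E : {set {set T}}) : rel T := fun x y => [set x; y] \in E.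

Definition connected (V : {set T}) (E : {set {set T}}) : Prop :=
  V != set0 /\ {in V &, forall x y, connect (adj E) x y}.

Definition matching (E M : {set {set T}}) : Prop :=
  M \subset E /\
  {in M &, forall f g : {set T}, f != g -> [disjoint f & g]}.

Definition maximal_matching (E M : {set {set T}}) : Prop :=
  matching E M /\ forall f, f \in E -> f \notin M -> ~ matching E (f |: M).

Definition equimatchable (V : {set T}) (E : {set {set T}}) : Prop :=
  forall M1 M2, maximal_matching E M1 -> maximal_matching E M2 -> #|M1| = #|M2|.

Definition del_vertex_E (E : {set {set T}}) (v : T) : {set {set T}} :=
  [set f in E | v \notin f].

Definition vertex_stable_equimatchable (V : {set T}) (E : {set {set T}}) : Prop :=
  equimatchable V E /\
  forall v, v \in V -> equimatchable (V :\ v) (del_vertex_E E v).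

Definition edge_stable_equimatchable (V : {set T}) (E : {set {set T}}) : Prop :=
  equimatchable V E /\ forall f, f \in E -> equimatchable V (E :\ f).

Definition complete (V : {set T}) (E : {set {set T}}) : Prop :=
  E = [set [set x; y] | x in V, y in V & x != y].

Definition complete_bipartite (V : {set T}) (E : {set {set T}}) : Prop :=
  exists A B : {set T},
    [/\ A != set0, B != set0, [disjoint A & B], V = A :|: B &
        E = [set [set a; b] | a in A, b in B]].

Definition bipartite (V : {set T}) (E : {set {set T}}) : Prop :=
  exists A : {set T}, A \subset V /\
    forall f, f \in E -> #|f :&: A| = 1.

End Graphs.

(* Main.v *)
(* Matchings enter only through the vertex sets they cover: G is equimatchable
   iff, whenever S and S' are covered by matchings and |S| < |S'|, some edge
   lies outside S.  Let D be the set of vertices missed by some maximum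
   matching, and let G be connected and vertex-stable equimatchable.
   - If D is empty, the maximum matchings are perfect; starting from an edge,
     one grows a spanning K_{n,n}, and any edge inside a side forces K_{2n}.
   - If u, v in D are adjacent, u is missed by a maximum matching M and vw is
     in M, then equimatchability of G - v forces w ~ u.  This triangle grows to
     an odd clique K, with M perfect on a set disjoint from K, until K = G.
   - If D is nonempty and independent, exchanging edges shows that every edge
     has exactly one end in D, so G is bipartite.  For an edge ad with d in D,
     equimatchability of G - d provides an edge other than ad outside any
     non-maximum matching, so G \ ad is equimatchable.
   Conversely, D is independent in a bipartite graph.  If G - v were not
   equimatchable, v would be in D, and edge-stability, applied to an edge vy
   witnessing that a matching of G - v extends in G, would put y in D too. *)

Require Import Defs.
From mathcomp Require Import all_boot.
From mathcomp Require Import zify.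

Set Implicit Arguments. Unset Strict Implicit. Unset Printing Implicit Defensive.

(* [lia] case-splits on every boolean hypothesis in the context, which blows up
   on the membership facts; only the arithmetical hypotheses are kept. *)
Ltac card_lia :=
  intros;
  repeat match goal with
  | H : ?P |- _ =>
    match type of P with
    | Prop =>
      lazymatch P with
      | is_true (leq _ _) => fail
      | is_true (odd _) => fail
      | is_true (~~ odd _) => fail
      | @eq nat _ _ => fail
      | _ => clear H
      end
    end
  end; lia.

(** * Vertex sets covered by matchings, and the stability notions in terms of them *)

Section Matchable.
Variable T : finType.
Implicit Types (V S R K X Y : {set T}) (E M : {set {set T}}) (x y u v : T).

(** Boolean, so that covered sets can be maximised over and collected inside finite types. *)
Definition matchable E S : bool :=
  [exists M : {set {set T}}, [&& M \subset E, trivIset M & cover M == S]].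

Lemma matchingP E M : matching E M <-> (M \subset E) && trivIset M.
Proof.
split=> [[sME dM]|/andP[sME /trivIsetP dM]]; last by [].
by rewrite sME; apply/trivIsetP.
Qed.

Lemma matchableP E S :
  reflect (exists2 M, matching E M & cover M = S) (matchable E S).
Proof.
apply: (iffP existsP) => [[M /and3P[sME tM /eqP <-]]|[M /matchingP mM <-]].
  by exists M => //; apply/matchingP; rewrite sME.
by exists M; rewrite andbA mM eqxx.
Qed.

Lemma adjC E x y : adj E x y = adj E y x.
Proof. by rewrite /adj setUC. Qed.

Lemma card_setU2 S x y :
  x \notin S -> y \notin S -> x != y -> #|x |: (y |: S)| = #|S|.+2.
Proof. by move=> xS yS xy; rewrite !cardsU1 !inE (negPf xy) (negPf xS) yS. Qed.

Lemma graph_edge V E f : is_graph V E -> f \in E ->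
  exists x y, [/\ f = [set x; y], adj E x y, x \in V, y \in V & x != y].
Proof.
move=> gE fE; have [sfV /eqP/cards2P[x [y [xy fxy]]]] := gE f fE.
exists x, y; split=> //; first by rewrite /adj -fxy.
  by apply: (subsetP sfV); rewrite fxy !inE eqxx.
by apply: (subsetP sfV); rewrite fxy !inE eqxx orbT.
Qed.

Lemma adj_neq V E x y : is_graph V E -> adj E x y -> x != y.
Proof.
move=> gE /gE[_]; apply: contra_eq_neq => ->.
by rewrite setUid cards1.
Qed.

Lemma adj_in V E x y : is_graph V E -> adj E x y -> (x \in V) /\ (y \in V).
Proof.
move=> gE /gE[sV _].
by split; apply: (subsetP sV); rewrite !inE eqxx ?orbT.
Qed.

Lemma matchable0 E : matchable E set0.
Proof.
apply/matchableP; exists set0; last by rewrite /cover big_set0.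
by apply/matchingP; rewrite sub0set; apply/trivIsetP=> A B; rewrite inE.
Qed.

Lemma matching_addP E M x y : matching E M -> adj E x y ->
  x \notin cover M -> y \notin cover M ->
  [/\ matching E ([set x; y] |: M), [set x; y] \notin M
    & cover ([set x; y] |: M) = x |: (y |: cover M)].
Proof.
move=> /matchingP/andP[sM tM] xy xM yM.
have nM : [set x; y] \notin M.
  by apply: contra xM => fM; apply/bigcupP; exists [set x; y]; rewrite ?inE ?eqxx.
split=> //; last by rewrite /cover big_setU1 //= setUA.
have dis (f : {set T}) : f \in M -> [disjoint [set x; y] & f].
  move=> fM; apply/pred0P=> z /=; rewrite !inE; apply/negP=> /andP[/orP[]/eqP-> zf].
    by case/negP: xM; apply/bigcupP; exists f.
  by case/negP: yM; apply/bigcupP; exists f.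
apply/matchingP; rewrite subUset sub1set (xy : [set x; y] \in E) sM /=.
apply/trivIsetP=> f g /setU1P[->|fM] /setU1P[->|gM]; rewrite ?eqxx //.
- by rewrite dis.
- by rewrite disjoint_sym dis.
- by move: f g fM gM; apply/trivIsetP.
Qed.

Lemma matchableU E S x y : adj E x y -> x \notin S -> y \notin S ->
  matchable E S -> matchable E (x |: (y |: S)).
Proof.
move=> xy xS yS /matchableP[M mM cM]; rewrite -cM in xS yS.
have [mM' _ cM'] := matching_addP mM xy xS yS.
by apply/matchableP; exists ([set x; y] |: M); rewrite // cM' cM.
Qed.

Lemma matchableD V E S x : is_graph V E -> matchable E S -> x \in S ->
  exists y R, [/\ adj E x y, x \notin R, y \notin R, matchable E R
                & S = x |: (y |: R)].
Proof.
move=> gE /matchableP[M mM <-] /bigcupP[f fM xf].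
have /matchingP/andP[sM tM] := mM.
have [y fxy] : exists y, f = [set x; y].
  have [a [b [fab _ _ _ _]]] := graph_edge gE (subsetP sM f fM).
  move: xf; rewrite fab !inE => /orP[]/eqP->; first by exists b.
  by exists a; rewrite setUC.
have xy : adj E x y by rewrite /adj -fxy (subsetP sM).
have nR z : z \in f -> z \notin cover (M :\ f).
  move=> zf; apply/negP=> /bigcupP[g]; rewrite !inE => /andP[gf gM] zg.
  move/trivIsetP/(_ g f gM fM gf)/pred0P/(_ z): tM.
  by rewrite /= zg zf.
exists y, (cover (M :\ f)); split=> //; first by rewrite nR // fxy !inE eqxx.
- by rewrite nR // fxy !inE eqxx orbT.
- apply/matchableP; exists (M :\ f) => //; apply/matchingP.
  rewrite (subset_trans (subsetDl _ _) sM) /=; apply/trivIsetP=> g h.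
  rewrite !inE => /andP[_ gM] /andP[_ hM]; move: g h gM hM.
  exact/trivIsetP.
by rewrite -{1}(setD1K fM) /cover big_setU1 ?inE ?eqxx //= fxy setUA.
Qed.

(** Removing the matching edge at any covered vertex leaves a smaller covered set, so facts about
    covered sets can be proved one edge at a time, with no matching in sight. *)
Lemma matchable_ind V E (P : {set T} -> Prop) : is_graph V E -> P set0 ->
  (forall S x y, matchable E S -> adj E x y -> x != y ->
     x \notin S -> y \notin S -> P S -> P (x |: (y |: S))) ->
  forall S, matchable E S -> P S.
Proof.
move=> gE P0 PU S; have [n] := ubnP #|S|; elim: n S => // n IH S ltSn mS.
have [->//|[x xS]] := set_0Vmem S.
have [y [R [xy xR yR mR defS]]] := matchableD gE mS xS.
have nxy := adj_neq gE xy.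
rewrite defS; apply: PU => //; apply: IH => //.
by move: ltSn; rewrite defS card_setU2 //; card_lia.
Qed.

Lemma matchable_sub V E S : is_graph V E -> matchable E S -> S \subset V.
Proof.
move=> gE; move: S; apply: (matchable_ind gE) => [|S x y _ xy _ _ _ sSV].
  exact: sub0set.
by have [xV yV] := adj_in gE xy; rewrite !subUset !sub1set xV yV.
Qed.

Lemma matchable_even V E S : is_graph V E -> matchable E S -> ~~ odd #|S|.
Proof.
move=> gE; move: S; apply: (matchable_ind gE) => [|S x y _ _ xy xS yS].
  by rewrite cards0.
by rewrite card_setU2 //= negbK.
Qed.

Lemma card_cover_matching V E M : is_graph V E -> matching E M ->
  #|cover M| = #|M| * 2.
Proof.
move=> gE /matchingP/andP[sM /eqP <-]; rewrite -sum_nat_const.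
by apply: eq_bigr => f fM; have [] := gE f (subsetP sM f fM).
Qed.

Lemma matchable_mono E E' S : E \subset E' -> matchable E S -> matchable E' S.
Proof.
move=> sE /matchableP[M [sM dM] <-]; apply/matchableP; exists M => //.
by split=> //; apply: subset_trans sE.
Qed.

Lemma maximal_matchingP V E M : is_graph V E ->
  maximal_matching E M <->
  matching E M /\
  ~ exists x y, [/\ adj E x y, x \notin cover M & y \notin cover M].
Proof.
move=> gE; split=> [[mM maxM]|[mM nM]]; split=> //.
  move=> [x [y [xy xM yM]]].
  by have [mM' fM _] := matching_addP mM xy xM yM; apply: maxM mM'.
move=> f fE fM mfM; have [x [y [fxy xy _ _ _]]] := graph_edge gE fE.
apply: nM; exists x, y; have [_ dM] := mfM.
have ncov z : z \in f -> z \notin cover M.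
  move=> zf; apply/negP=> /bigcupP[g gM zg].
  have fg : f != g by apply: contraNneq fM => ->.
  have /pred0P/(_ z) /= := dM f g (setU11 _ _) (setU1r _ gM) fg.
  by rewrite zf zg.
by split=> //; apply: ncov; rewrite fxy !inE eqxx ?orbT.
Qed.

Definition extendable E : Prop :=
  forall S S', matchable E S -> matchable E S' -> #|S| < #|S'| ->
    exists x y, [/\ adj E x y, x \notin S & y \notin S].

(** [M'] need not contain [M]: it is a largest matching among those with at least [#|M|] edges,
    hence maximal. *)
Lemma maximal_extension V E M : is_graph V E -> matching E M ->
  exists2 M', maximal_matching E M' & #|M| <= #|M'|.
Proof.
move=> gE mM; pose P M' := [&& M' \subset E, trivIset M' & #|M| <= #|M'|].
have PM : P M by rewrite /P leqnn andbT; apply/matchingP.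
have [M' PM' maxM'] := @arg_maxnP _ M P (fun M' => #|M'|) PM.
have /and3P[sM' tM' leM] := PM'.
have mM' : matching E M' by apply/matchingP/andP.
exists M' => //; apply/(maximal_matchingP _ gE); split=> // -[x [y [xy xM yM]]].
have [/matchingP/andP[s2 t2] fM' _] := matching_addP mM' xy xM yM.
have := maxM' ([set x; y] |: M'); rewrite /P s2 t2 /= cardsU1 fM' /= add1n.
by move=> /(_ (leqW leM)); rewrite ltnn.
Qed.

(** A matching is maximal exactly when no edge lies outside its cover, and a cover has twice as many
    vertices as the matching has edges. So a failure of either side yields two maximal matchings of
    different sizes. *)
Lemma equimatchableP V E : is_graph V E -> equimatchable V E <-> extendable E.
Proof.
move=> gE; split=> [eqE S S'|exE M1 M2 max1 max2].
  move=> /matchableP[M mM <-] /matchableP[M' mM' <-].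
  rewrite !(card_cover_matching gE) // => ltM.
  have [/existsP[x /existsP[y /and3P[]]]|no] :=
    boolP [exists x, exists y, [&& adj E x y, x \notin cover M & y \notin cover M]].
    by exists x, y.
  have [M'' maxM'' leM] := maximal_extension gE mM'.
  have maxM : maximal_matching E M.
    apply/(maximal_matchingP _ gE); split=> // -[x [y [xy xM yM]]].
    by case/negP: no; apply/existsP; exists x; apply/existsP; exists y; apply/and3P.
  by have := eqE M M'' maxM maxM''; card_lia.
have half N1 N2 : maximal_matching E N1 -> maximal_matching E N2 -> #|N2| <= #|N1|.
  move=> /(maximal_matchingP _ gE)[m1 n1] /(maximal_matchingP _ gE)[m2 _].
  rewrite leqNgt; apply/negP=> lt12; apply: n1; apply: exE.
  - by apply/matchableP; exists N1.
  - by apply/matchableP; exists N2.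
  - by rewrite !(card_cover_matching gE) // ltn_pmul2r.
by apply/eqP; rewrite eqn_leq !half.
Qed.

Lemma matchable_del_vertex E v S :
  matchable (del_vertex_E E v) S = matchable E S && (v \notin S).
Proof.
apply/matchableP/andP => [[M [sM dM] <-]|[/matchableP[M [sM dM] <-] vM]].
  split; last first.
    apply/negP=> /bigcupP[f /(subsetP sM)]; rewrite inE => /andP[_ /negP]; exact.
  apply/matchableP; exists M => //; split=> //.
  by apply: subset_trans sM _; apply/subsetP=> f; rewrite inE => /andP[].
exists M => //; split=> //; apply/subsetP=> f fM; rewrite inE (subsetP sM) //.
by apply: contra vM => vf; apply/bigcupP; exists f.
Qed.

Lemma adj_del_vertex E v x y :
  adj (del_vertex_E E v) x y = [&& adj E x y, x != v & y != v].
Proof. by rewrite /adj inE !inE negb_or ![v == _]eq_sym. Qed.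

Lemma graph_del_vertex V E v :
  is_graph V E -> is_graph (V :\ v) (del_vertex_E E v).
Proof.
move=> gE f; rewrite inE => /andP[/gE[sV c2] vf]; split=> //.
by rewrite subsetD1 sV.
Qed.

(** This is [extendable] for $G-v$, phrased over [E] itself so that covered sets of $G$ and of $G-v$
    can be compared directly. *)
Definition extendable_avoiding E v : Prop :=
  forall S S', matchable E S -> matchable E S' -> v \notin S -> v \notin S' ->
    #|S| < #|S'| ->
    exists x y, [/\ adj E x y, x \notin S, y \notin S, x != v & y != v].

Lemma vertex_stableP V E : is_graph V E -> vertex_stable_equimatchable V E <->
  extendable E /\ {in V, forall v, extendable_avoiding E v}.
Proof.
move=> gE; rewrite /vertex_stable_equimatchable (equimatchableP gE).
have ex v : equimatchable (V :\ v) (del_vertex_E E v) <-> extendable_avoiding E v.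
  rewrite (equimatchableP (graph_del_vertex gE)).
  split=> ex S S' => [mS mS' vS vS'|]; last first.
    rewrite !matchable_del_vertex => /andP[mS vS] /andP[mS' vS'] lt.
    have [x [y [xy xS yS xv yv]]] := ex S S' mS mS' vS vS' lt.
    by exists x, y; rewrite adj_del_vertex xy xv yv.
  case/ex; rewrite ?matchable_del_vertex ?mS ?mS' //.
  move=> x [y []]; rewrite adj_del_vertex => /and3P[xy xv yv] xS yS.
  by exists x, y.
by split=> -[eE sE]; split=> // v vV; apply/ex; apply: sE.
Qed.

Lemma edge_stableP V E : is_graph V E -> edge_stable_equimatchable V E <->
  extendable E /\ forall f, f \in E -> extendable (E :\ f).
Proof.
move=> gE; rewrite /edge_stable_equimatchable (equimatchableP gE).
have gD f : is_graph V (E :\ f) by move=> g; rewrite inE => /andP[_ /gE].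
by split=> -[eE sE]; split=> // f fE; apply/(equimatchableP (gD f)); apply: sE.
Qed.

Lemma matchable_del_edge E x y S :
  matchable E S -> x \notin S -> matchable (E :\ [set x; y]) S.
Proof.
move=> /matchableP[M [sM dM] <-] xM; apply/matchableP; exists M => //; split=> //.
rewrite subsetD1 sM; apply: contra xM => fM.
by apply/bigcupP; exists [set x; y]; rewrite // !inE eqxx.
Qed.

(** Without such an edge [K] would be closed under adjacency and so contain everything reachable
    from it. *)
Lemma connected_cut V E K : is_graph V E -> connected V E ->
  K != set0 -> K \subset V -> K != V ->
  exists x y, [/\ x \in K, y \notin K & adj E x y].
Proof.
move=> gE [_ cE] /set0Pn[k kK] sKV nKV.
have [/existsP[x /existsP[y /and3P[]]]|no] :=
    boolP [exists x, exists y, [&& x \in K, y \notin K & adj E x y]].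
  by exists x, y.
case/eqP: nKV; apply/eqP; rewrite eqEsubset sKV; apply/subsetP=> z zV.
have st x y : adj E x y -> x \in K -> y \in K.
  move=> xy xK; apply: contraNT no => yK.
  by apply/existsP; exists x; apply/existsP; exists y; apply/and3P.
have cl : closed (adj E) K.
  by move=> x y xy; apply/idP/idP; apply: st; rewrite // adjC.
by rewrite -(closed_connect cl (cE k z (subsetP sKV k kK) zV)).
Qed.

End Matchable.

(** * Maximum covered sets and the vertices they miss *)

Section Maximum.
Variables (T : finType) (V : {set T}) (E : {set {set T}}).
Hypothesis gE : is_graph V E.
Implicit Types (S R K P Q X Y : {set T}) (x y z u v : T).

Definition maximum S : bool :=
  matchable E S && [forall S' : {set T}, matchable E S' ==> (#|S'| <= #|S|)].

(** The set $D$ of the Gallai-Edmonds decomposition. *)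
Definition missable : {set T} :=
  [set x in V | [exists S : {set T}, maximum S && (x \notin S)]].

Lemma maximum_exists : exists S, maximum S.
Proof.
case: (@arg_maxnP _ _ (matchable E) (fun S : {set T} => #|S|) (matchable0 E)).
move=> S mS maxS; exists S; rewrite /maximum mS.
by apply/forallP=> S'; apply/implyP; apply: maxS.
Qed.

Lemma maximum_le S S' : maximum S -> matchable E S' -> #|S'| <= #|S|.
Proof. by case/andP=> _ /forallP/(_ S')/implyP. Qed.

Lemma maximum_matchable S : maximum S -> matchable E S.
Proof. by case/andP. Qed.

Lemma maximum_ge S S' : maximum S -> matchable E S' -> #|S| <= #|S'| -> maximum S'.
Proof.
move=> maxS mS' le; rewrite /maximum mS'; apply/forallP=> R; apply/implyP=> mR.
exact: leq_trans (maximum_le maxS mR) le.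
Qed.

Lemma maximum_independent S x y :
  maximum S -> x \notin S -> y \notin S -> ~~ adj E x y.
Proof.
move=> maxS xS yS; apply/negP=> xy.
have := maximum_le maxS (matchableU xy xS yS (maximum_matchable maxS)).
by rewrite card_setU2 ?(adj_neq gE xy) //; card_lia.
Qed.

Lemma missableP x : x \in V ->
  reflect (exists2 S, maximum S & x \notin S) (x \in missable).
Proof.
move=> xV; rewrite inE xV; apply: (iffP existsP) => [[S /andP[]]|[S]].
  by exists S.
by exists S; apply/andP.
Qed.

Lemma card_disjoint_setU K P :
  {in K, forall z, z \notin P} -> #|K :|: P| = #|K| + #|P|.
Proof.
move=> dKP; rewrite cardsU disjoint_setI0 ?cards0 ?subn0 //.
by apply/pred0P=> z /=; apply/negP=> /andP[/dKP/negP].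
Qed.

Lemma matchable_clique K P : {in K &, forall x y, x != y -> adj E x y} ->
  ~~ odd #|K| -> matchable E P -> {in K, forall z, z \notin P} ->
  matchable E (K :|: P).
Proof.
have [n] := ubnP #|K|; elim: n K => // n IH K ltK clK eK mP dKP.
have [->|[x xK]] := set_0Vmem K; first by rewrite set0U.
have cK := cardsD1 x K; rewrite xK in cK.
have [K0|[y yK]] := set_0Vmem (K :\ x).
  by move: eK; rewrite cK K0 cards0.
have cK' := cardsD1 y (K :\ x); rewrite yK in cK'.
move: yK; rewrite !inE => /andP[yx yK].
have -> : K :|: P = x |: (y |: ((K :\ x :\ y) :|: P)).
  apply/setP=> z; rewrite !inE.
  have [->|_] := eqVneq z x; first by rewrite xK.
  by have [->|_] := eqVneq z y; first by rewrite yK.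
apply: matchableU.
- by apply: clK; rewrite // eq_sym.
- by rewrite !inE eqxx andbF (negPf (dKP _ xK)).
- by rewrite !inE eqxx (negPf (dKP _ yK)).
apply: IH => //.
- by card_lia.
- by move=> u v; rewrite !inE => /and3P[_ _ uK] /and3P[_ _ vK]; apply: clK.
- by move: eK; rewrite cK cK' /= negbK.
- by move=> z; rewrite !inE => /and3P[_ _ /dKP].
Qed.

Lemma matchable_biclique X Y P : {in X & Y, forall x y, adj E x y} ->
  #|X| = #|Y| -> {in X, forall z, z \notin Y} -> matchable E P ->
  {in X :|: Y, forall z, z \notin P} -> matchable E (X :|: Y :|: P).
Proof.
have [n] := ubnP #|X|; elim: n X Y => // n IH X Y ltX bXY cXY dXY mP dP.
have [X0|[x xX]] := set_0Vmem X.
  have /eqP: #|Y| = 0 by rewrite -cXY X0 cards0.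
  by rewrite cards_eq0 X0 => /eqP->; rewrite !set0U.
have cX := cardsD1 x X; rewrite xX in cX.
have [Y0|[y yY]] := set_0Vmem Y; first by move: cXY; rewrite cX Y0 cards0.
have cY := cardsD1 y Y; rewrite yY in cY.
have yX : y \notin X by apply: contraL yY; apply: dXY.
have yx : y != x by apply: contraNneq yX => ->.
have -> : X :|: Y :|: P = x |: (y |: ((X :\ x) :|: (Y :\ y) :|: P)).
  apply/setP=> z; rewrite !inE.
  have [->|_] := eqVneq z x; first by rewrite xX.
  by have [->|_] := eqVneq z y; first by rewrite yY orbT.
have [xP yP] : x \notin P /\ y \notin P by split; apply: dP; rewrite inE ?xX ?yY ?orbT.
apply: matchableU.
- exact: bXY.
- by rewrite !inE eqxx (negPf xP) (negPf (dXY _ xX)) andbF.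
- by rewrite !inE eqxx (negPf yP) (negPf yX) andbF.
apply: IH => //.
- by card_lia.
- by move=> u v; rewrite !inE => /andP[_ uX] /andP[_ vY]; apply: bXY.
- by card_lia.
- by move=> z; rewrite !inE => /andP[_ /dXY/negPf->]; rewrite andbF.
- by move=> z; rewrite !inE => /orP[] /andP[_ h]; apply: dP; rewrite inE h ?orbT.
Qed.

(* Deleting [v] keeps the matching number, so the matching [S] minus [vw] can be
   extended in [G - v]; the new edge must be [wu], else [S] would be augmented. *)
Lemma missable_triangle S u v : extendable_avoiding E v ->
  maximum S -> u \notin S -> v \in missable -> adj E u v ->
  exists w R, [/\ matchable E R, #|R|.+2 = #|S|,
    [/\ u \notin R, v \notin R & w \notin R], adj E u w & adj E v w].
Proof.
move=> ex maxS uS vD uv; have [uV vV] := adj_in gE uv.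
have vS : v \in S.
  by apply: contraTT uv => vS; apply: maximum_independent maxS uS vS.
have [w [R [vw vR wR mR defS]]] := matchableD gE (maximum_matchable maxS) vS.
have cS : #|S| = #|R|.+2 by rewrite defS card_setU2 // (adj_neq gE vw).
have /(missableP vV)[Sv maxSv vSv] := vD.
have cSv := maximum_le maxSv (maximum_matchable maxS).
have [|x [y [xy xR yR xv yv]]] :=
  ex _ _ mR (maximum_matchable maxSv) vR vSv.
  by apply: leq_trans cSv; rewrite cS.
have /and3P[_ uw uR] : [&& u != v, u != w & u \notin R].
  by move: uS; rewrite defS !inE !negb_or.
exists w, R; split; rewrite ?cS //.
wlog xw : x y xy xR yR xv yv / x = w => [wlogW|].
  have [xw|nxw] := eqVneq x w; first exact: (wlogW x y).
  have [yw|nyw] := eqVneq y w; first by apply: (wlogW y x); rewrite // adjC.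
  have /negP[] : ~~ adj E x y; last by [].
  by apply: maximum_independent maxS _ _; rewrite defS !inE !negb_or ?xv ?nxw ?yv ?nyw.
subst x; have yw : w != y := adj_neq gE xy.
have [<-|uy] := eqVneq y u; first by rewrite adjC.
have mB := matchableU xy xR yR mR.
have uB : u \notin w |: (y |: R) by rewrite !inE !negb_or uw eq_sym uy.
have vB : v \notin w |: (y |: R).
  by rewrite !inE !negb_or eq_sym xv eq_sym yv.
have := maximum_le maxS (matchableU uv uB vB mB).
by rewrite !card_setU2 ?(adj_neq gE uv) //; card_lia.
Qed.

(** * Vertex-stable graphs, according to the vertices missed by maximum matchings *)

Section Grow.
Hypothesis cE : connected V E.

Lemma clique_complete :
  {in V &, forall x y, x != y -> adj E x y} -> complete V E.
Proof.
move=> clV; apply/setP=> f; apply/idP/imset2P => [fE|[x y xV]].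
  have [x [y [-> _ xV yV xy]]] := graph_edge gE fE.
  by exists x y; rewrite // inE yV.
by rewrite inE => /andP[yV xy] ->; apply: clV.
Qed.

(** * Two adjacent missable vertices: growing an odd clique to the whole graph *)

Section OddClique.
Variables (S K Q : {set T}) (a b : T).
Hypothesis maxS : maximum S.
Hypothesis ex : {in V, forall v, extendable_avoiding E v}.
Hypotheses (sKV : K \subset V) (oK : odd #|K|) (gtK : 2 < #|K|).
Hypothesis clK : {in K &, forall x y, x != y -> adj E x y}.
Hypotheses (mQ : matchable E Q) (dKQ : {in K, forall z, z \notin Q}).
Hypotheses (ab : adj E a b) (aQ : a \notin Q) (bQ : b \notin Q).
Hypotheses (aK : a \notin K) (bK : b \notin K).
Hypothesis cardKQ : #|K| + #|Q| = #|S|.-1.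
Hypothesis cS : 0 < #|S|.

(** Delete a third vertex [k2] of [K]. The edge [k0 a], a perfect matching of [K] minus [k0], [k1],
    [k2], and [Q] cover fewer vertices than [ab], [K] minus [k2], and [Q], so $G-k_2$ has an edge
    outside the smaller set. Its ends are [k1], [b] or vertices outside all these sets; the latter
    have no edge to [k1], to [b] or among themselves, because [S] is maximum. *)
Lemma odd_clique_neighbour k0 k1 : k0 \in K -> k1 \in K -> k1 != k0 ->
  adj E k0 a -> adj E k1 b.
Proof.
move=> k0K k1K k10 k0a.
have nab := adj_neq gE ab; have nba : b != a by rewrite eq_sym.
have neK z k : k \in K -> z \notin K -> (k == z) = false.
  by move=> kK zK; apply: contraNF zK => /eqP<-.
have card1 k : k \in K -> #|K :\ k| = #|K|.-1.
  by move=> kK; have := cardsD1 k K; rewrite kK; card_lia.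
have evenD k : k \in K -> ~~ odd #|K :\ k|.
  by move=> /card1->; move: oK gtK; case: #|K|.
have mD k : k \in K -> matchable E ((K :\ k) :|: Q).
  move=> kK; apply: matchable_clique; rewrite ?evenD //.
    by move=> x y; rewrite !inE => /andP[_ xK] /andP[_ yK]; apply: clK.
  by move=> z; rewrite inE => /andP[_ /dKQ].
have cD k : k \in K -> #|(K :\ k) :|: Q| = #|K|.-1 + #|Q|.
  move=> kK; rewrite card_disjoint_setU ?card1 //.
  by move=> z; rewrite inE => /andP[_ /dKQ].
have nD z k : z \notin K -> z \notin Q -> z \notin (K :\ k) :|: Q.
  by move=> zK zQ; rewrite !inE (negPf zK) (negPf zQ) andbF.
have kD k : k \in K -> k \notin (K :\ k) :|: Q.
  by move=> kK; rewrite !inE eqxx (negPf (dKQ kK)).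
have aD k : a \notin (K :\ k) :|: Q by apply: nD.
have bD k : b \notin (K :\ k) :|: Q by apply: nD.
(* [K] minus one vertex is an even clique, hence perfectly matchable; with [Q] and [ab] it reaches
   the size of [S]. *)
have maxD k : k \in K -> maximum (a |: (b |: ((K :\ k) :|: Q))).
  move=> kK; apply: (maximum_ge maxS); first by apply: matchableU; rewrite ?mD.
  by rewrite card_setU2 // cD //; card_lia.
(* These are the vertices missed by all the maximum sets of [maxD] at once; the set for [k] also
   misses [k]. *)
pose out z := [&& z \notin K, z != a, z != b & z \notin Q].
have indep k x y : k \in K -> (x == k) || out x -> (y == k) || out y -> ~~ adj E x y.
  move=> kK hx hy.
  have h z : (z == k) || out z -> z \notin a |: (b |: ((K :\ k) :|: Q)).
    case/orP=> [/eqP->|/and4P[zK za zb zQ]].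
      by rewrite !inE eqxx (neK a) // (neK b) // (negPf (dKQ kK)).
    by rewrite !inE (negPf zK) (negPf za) (negPf zb) (negPf zQ) andbF.
  by apply: (maximum_independent (maxD k kK)); apply: h.
(* Otherwise [k0 a], [bz], [K] minus [k0], and [Q] would cover [#|S| + 2] vertices. *)
have bout z : out z -> ~~ adj E b z.
  case/and4P=> zK za zb zQ; apply/negP=> bz.
  have k0A : k0 \notin a |: ((K :\ k0) :|: Q).
    by rewrite !inE eqxx (neK a) // (negPf (dKQ k0K)).
  have m1 := matchableU k0a (kD k0 k0K) (aD k0) (mD k0 k0K).
  have bA : b \notin k0 |: (a |: ((K :\ k0) :|: Q)).
    by rewrite 2!inE negb_or eq_sym (neK b) // inE negb_or inE nba bD.
  have zA : z \notin k0 |: (a |: ((K :\ k0) :|: Q)).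
    by rewrite 2!inE negb_or eq_sym (neK z) // inE negb_or inE za nD.
  have := maximum_le maxS (matchableU bz bA zA m1).
  have bz' : b != z by rewrite eq_sym.
  have k0a' := adj_neq gE k0a.
  by rewrite (card_setU2 bA zA bz') (card_setU2 (kD _ k0K) (aD k0) k0a') cD //; card_lia.
(* The vertex to delete: in [G - k2] the edge [k0 a] leaves [k1] and [b] only. *)
have [k2 /and3P[k2K k20 k21]] : exists k2, [&& k2 \in K, k2 != k0 & k2 != k1].
  have /card_gt0P[k2] : 0 < #|K :\ k0 :\ k1|.
    have := cardsD1 k1 (K :\ k0); rewrite !inE k10 k1K card1 //; card_lia.
  by rewrite !inE => /and3P[k21 k20 k2K]; exists k2; apply/and3P.
pose L := K :\ k0 :\ k1 :\ k2.
have cL : #|L|.+3 = #|K|.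
  have := cardsD1 k2 (K :\ k0 :\ k1); have := cardsD1 k1 (K :\ k0).
  have := cardsD1 k0 K; rewrite !inE k0K k10 k1K k21 k20 k2K /L; card_lia.
have LK z : z \in L -> z \in K by rewrite !inE => /and4P[].
have dLQ : {in L, forall z, z \notin Q} by move=> z /LK/dKQ.
have mL : matchable E (L :|: Q).
  apply: matchable_clique => //; last by move: oK; rewrite -cL /= negbK.
  by move=> x y /LK xK /LK yK; apply: clK.
have k0L : k0 \notin L :|: Q by rewrite !inE eqxx (negPf (dKQ k0K)) !andbF.
have aL : a \notin L :|: Q by rewrite !inE (negPf aK) (negPf aQ) !andbF.
have m1 := matchableU k0a k0L aL mL.
have k2m1 : k2 \notin k0 |: (a |: (L :|: Q)).
  by rewrite !inE eqxx (negPf k20) neK // (negPf (dKQ k2K)).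
have k2m2 : k2 \notin a |: (b |: ((K :\ k2) :|: Q)).
  by rewrite !inE eqxx !neK // (negPf (dKQ k2K)).
have [|x [y [xy xm ym x2 y2]]] := ex (subsetP sKV _ k2K) m1
    (maximum_matchable (maxD k2 k2K)) k2m1 k2m2.
  rewrite (card_setU2 k0L aL (adj_neq gE k0a)) (card_setU2 (aD k2) (bD k2) nab).
  by rewrite cD // card_disjoint_setU //; card_lia.
have cases z : z \notin k0 |: (a |: (L :|: Q)) -> z != k2 ->
    [|| z == k1, z == b | out z].
  rewrite !inE /out; case: (z == b); first by rewrite orbT.
  by case: (z == k0); case: (z == a); case: (z == k1); case: (z == k2);
    case: (z \in K); case: (z \in Q).
move: (cases x xm x2) (cases y ym y2).
(* Of the nine cases only an edge between [k1] and [b] survives. *)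
case/or3P=> [/eqP xe|/eqP xe|ox] /or3P[/eqP ye|/eqP ye|oy]; subst => //.
- by move: (adj_neq gE xy); rewrite eqxx.
- by move: xy; rewrite (negPf (indep k1 _ _ _ _ _)) ?eqxx ?oy ?orbT.
- by rewrite adjC.
- by move: (adj_neq gE xy); rewrite eqxx.
- by move: xy; rewrite (negPf (bout _ oy)).
- by move: xy; rewrite (negPf (indep k1 _ _ _ _ _)) ?eqxx ?ox ?orbT.
- by move: xy; rewrite adjC (negPf (bout _ ox)).
- by move: xy; rewrite (negPf (indep k0 _ _ _ _ _)) ?ox ?oy ?orbT.
Qed.

End OddClique.

(** Induction on the number of vertices outside [K]. The invariant on sizes says that [P] together
    with [K] minus any one vertex is a maximum covered set. A vertex [a] adjacent to [K] is covered
    by [P], and it joins [K] together with its partner [b]. *)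
Lemma odd_clique_grow S K P : {in V, forall v, extendable_avoiding E v} ->
  maximum S -> K \subset V -> odd #|K| -> 2 < #|K| ->
  {in K &, forall x y, x != y -> adj E x y} ->
  matchable E P -> {in K, forall z, z \notin P} -> #|K| + #|P| = #|S|.+1 ->
  complete V E.
Proof.
move=> ex maxS; have [n] := ubnP #|V :\: K|.
elim: n K P => // n IH K P ltn sKV oK gtK clK mP dKP cKP.
have [KV|nKV] := eqVneq K V; first by apply: clique_complete; rewrite -KV.
have K0 : K != set0 by rewrite -card_gt0; card_lia.
have [k0 [a [k0K aK k0a]]] := connected_cut gE cE K0 sKV nKV.
have [_ aV] := adj_in gE k0a.
(* Otherwise the maximum set formed by [P] and [K] minus [k0] would miss both ends of [k0 a]. *)
have aP : a \in P.
  apply: contraTT k0a => aP.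
  have k0D : k0 \notin (K :\ k0) :|: P by rewrite !inE eqxx (negPf (dKP _ k0K)).
  have aD : a \notin (K :\ k0) :|: P by rewrite !inE (negPf aK) (negPf aP) andbF.
  have cK := cardsD1 k0 K; rewrite k0K in cK.
  have dD : {in K :\ k0, forall z, z \notin P} by move=> z /setD1P[_ /dKP].
  apply: (maximum_independent _ k0D aD); apply: (maximum_ge maxS).
    apply: matchable_clique => //; last by move: oK; rewrite cK.
    by move=> x y /setD1P[_ xK] /setD1P[_ yK]; apply: clK.
  by rewrite card_disjoint_setU //; card_lia.
have [b [Q [ab aQ bQ mQ defP]]] := matchableD gE mP aP.
have [_ bV] := adj_in gE ab.
have nab := adj_neq gE ab.
have cP : #|P| = #|Q|.+2 by rewrite defP card_setU2.
have bK : b \notin K by apply/negP=> /dKP; rewrite defP !inE eqxx orbT.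
have dKQ : {in K, forall z, z \notin Q}.
  by move=> z /dKP; rewrite defP !inE !negb_or => /and3P[].
have cKQ : #|K| + #|Q| = #|S|.-1 by card_lia.
have cS : 0 < #|S| by card_lia.
have ba : adj E b a by rewrite adjC.
have toB k k' := @odd_clique_neighbour S K Q a b maxS ex sKV oK gtK clK mQ dKQ
  ab aQ bQ aK bK cKQ cS k k'.
have toA k k' := @odd_clique_neighbour S K Q b a maxS ex sKV oK gtK clK mQ dKQ
  ba bQ aQ bK aK cKQ cS k k'.
have other k k' : exists k2, [/\ k2 \in K, k2 != k & k2 != k'].
  have /card_gt0P[k2] : 0 < #|K :\ k :\ k'|.
    have := cardsD1 k' (K :\ k); have := cardsD1 k K.
    by case: (k \in K); case: (k' \in _); card_lia.
  by rewrite !inE => /and3P[]; exists k2.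
(* Two applications: [k0 a] gives [k1 b], which gives [k a]. The vertex [k1] differs from [k0] and
   [k], so [k] may be [k0] itself. *)
have allA k : k \in K -> adj E k a.
  move=> kK; have [k1 [k1K k10 k1k]] := other k0 k.
  by apply: (toA k1) => //; [rewrite eq_sym | apply: (toB k0)].
have allB k : k \in K -> adj E k b.
  move=> kK; have [k1 [k1K k10 k1k]] := other k k.
  by apply: (toB k1) => //; [rewrite eq_sym | apply: allA].
apply: (IH (a |: (b |: K)) Q) => //.
- suff: V :\: (a |: (b |: K)) \proper V :\: K by move/proper_card; card_lia.
  apply/properP; split; last by exists a; rewrite !inE ?eqxx ?aK.
  by apply: setDS; rewrite setUA subsetUr.
- by rewrite !subUset !sub1set aV bV.
- by rewrite card_setU2 //= negbK.
- by rewrite card_setU2 //; card_lia.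
- move=> x y /setU1P[->|/setU1P[->|xK]] /setU1P[->|/setU1P[->|yK]];
    rewrite ?eqxx // => nxy.
  + by rewrite adjC allA.
  + by rewrite adjC allB.
  + exact: allA.
  + exact: allB.
  + exact: clK.
- by move=> z /setU1P[->|/setU1P[->|/dKQ]].
- by rewrite card_setU2 //; card_lia.
Qed.

(** The triangle [u], [v], [w] starts the growth, with [R] as [P]: [3 + #|R|] is [#|S| + 1]. *)
Lemma missable_edge_complete u v : {in V, forall v, extendable_avoiding E v} ->
  u \in missable -> v \in missable -> adj E u v -> complete V E.
Proof.
move=> ex uD vD uv; have [uV vV] := adj_in gE uv.
have /(missableP uV)[S maxS uS] := uD.
have [w [R [mR cR [uR vR wR] uw vw]]] := missable_triangle (ex v vV) maxS uS vD uv.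
have [_ wV] := adj_in gE uw.
have nvw := adj_neq gE vw; have nuw := adj_neq gE uw; have nuv := adj_neq gE uv.
have cK : #|u |: (v |: [set w])| = 3 by rewrite card_setU2 ?inE ?cards1.
apply: (@odd_clique_grow S (u |: (v |: [set w])) R) => //; rewrite ?cK //.
- by rewrite !subUset !sub1set uV vV.
- move=> x y; rewrite !inE => /or3P[]/eqP-> /or3P[]/eqP->;
    by rewrite ?eqxx // adjC.
- by move=> z; rewrite !inE => /or3P[]/eqP->.
- by card_lia.
Qed.

(** * Perfect matchings: growing a balanced biclique to the whole graph *)

(** The edge [k0 a], a perfect matching between [X] minus [k0] and [Y] minus [y], and [Q] leave
    exactly [b] and [y] uncovered. As [V] itself is covered by a matching, these two must be
    adjacent. *)
Lemma biclique_neighbour X Y Q a b k0 y : extendable E -> matchable E V ->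
  {in X & Y, forall x y, adj E x y} ->
  #|X| = #|Y| -> {in X, forall z, z \notin Y} -> matchable E Q ->
  {in X :|: Y, forall z, z \notin Q} ->
  V = a |: (b |: (X :|: Y :|: Q)) ->
  a \notin X :|: Y :|: Q -> b \notin X :|: Y :|: Q -> a != b ->
  k0 \in X -> adj E k0 a -> y \in Y -> adj E b y.
Proof.
move=> ex mV bXY cXY dXY mQ dQ defV; rewrite !inE !negb_or.
move=> /andP[/andP[aX aY] aQ] /andP[/andP[bX bY] bQ] nab k0X k0a yY.
have k0Y := dXY k0 k0X; have yX : y \notin X by apply: contraL yY; apply: dXY.
have [k0Q yQ] : k0 \notin Q /\ y \notin Q by split; apply: dQ; rewrite inE ?k0X ?yY ?orbT.
have mR : matchable E ((X :\ k0) :|: (Y :\ y) :|: Q).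
  apply: matchable_biclique => //.
  - by move=> u v /setD1P[_ uX] /setD1P[_ vY]; apply: bXY.
  - by have := cardsD1 k0 X; have := cardsD1 y Y; rewrite k0X yY; card_lia.
  - by move=> z /setD1P[_ /dXY/negPf zY]; rewrite inE zY andbF.
  - by move=> z; rewrite !inE => /orP[] /andP[_ h]; apply: dQ; rewrite inE h ?orbT.
have k0R : k0 \notin (X :\ k0) :|: (Y :\ y) :|: Q.
  by rewrite !inE eqxx (negPf k0Y) (negPf k0Q) andbF.
have aR : a \notin (X :\ k0) :|: (Y :\ y) :|: Q.
  by rewrite !inE (negPf aX) (negPf aY) (negPf aQ) !andbF.
have mS := matchableU k0a k0R aR mR.
set S := _ |: _ in mS.
have yb : y != b by apply: contraNneq bY => <-.
have outS z : z \in V -> z \notin S -> z = b \/ z = y.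
  rewrite defV /S !inE.
  have [->|_] := eqVneq z b; first by left.
  have [->|_] := eqVneq z y; first by right.
  by case: (z == k0); case: (z == a); case: (z \in X); case: (z \in Y); case: (z \in Q).
have bS : b \notin S.
  have bk : b != k0 by apply: contraNneq bX => ->.
  by rewrite !inE (negPf bk) eq_sym (negPf nab) (negPf bX) (negPf bY) (negPf bQ) !andbF.
have ltS : #|S| < #|V|.
  apply: proper_card; apply/properP; split; first exact: matchable_sub mS.
  by exists b; rewrite // defV !inE eqxx orbT.
have [p [q [pq pS qS]]] := ex _ _ mS mV ltS.
have [pV qV] := adj_in gE pq; have npq := adj_neq gE pq.
have [pe|pe] := outS p pV pS; have [qe|qe] := outS q qV qS; subst => //.
- by rewrite eqxx in npq.
- by rewrite adjC.
- by rewrite eqxx in npq.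
Qed.

(** Induction on [#|P|]. For an edge [k0 a] leaving the biclique at [X], the partner [b] of [a] in
    [P] joins [X] and [a] joins [Y]. *)
Lemma biclique_grow X Y P : extendable E -> matchable E V ->
  {in X & Y, forall x y, adj E x y} -> X != set0 ->
  #|X| = #|Y| -> {in X, forall z, z \notin Y} -> matchable E P ->
  {in X :|: Y, forall z, z \notin P} -> V = X :|: Y :|: P ->
  exists X' Y', [/\ {in X' & Y', forall x y, adj E x y}, X' != set0,
    #|X'| = #|Y'|, {in X', forall z, z \notin Y'} & V = X' :|: Y'].
Proof.
move=> ex mV; have [n] := ubnP #|P|; elim: n X Y P => // n IH X Y P.
move=> ltP bXY X0 cXY dXY mP dP defV.
have [KV|nKV] := eqVneq (X :|: Y) V; first by exists X, Y.
have K0 : X :|: Y != set0 by rewrite setU_eq0 (negPf X0).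
have sKV : X :|: Y \subset V by rewrite defV subsetUl.
have [k0 [a [k0K aK k0a]]] := connected_cut gE cE K0 sKV nKV.
wlog k0X : X Y bXY X0 cXY dXY dP defV nKV K0 sKV k0K aK / k0 \in X => [hw|].
  have [k0X|k0X] := boolP (k0 \in X); first exact: (hw X Y).
  have k0Y : k0 \in Y by move: k0K; rewrite inE (negPf k0X).
  apply: (hw Y X); rewrite // 1?(setUC Y) //.
  - by move=> x y xY yX; rewrite adjC bXY.
  - by rewrite -card_gt0 -cXY card_gt0.
  - by move=> z zY; apply: contraL zY; apply: dXY.
have [_ aV] := adj_in gE k0a.
have aP : a \in P by move: aV; rewrite defV inE (negPf aK).
have [b [Q [ab aQ bQ mQ defP]]] := matchableD gE mP aP.
have nab := adj_neq gE ab.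
have cP : #|P| = #|Q|.+2 by rewrite defP card_setU2.
have bK : b \notin X :|: Y by apply/negP=> /dP; rewrite defP !inE eqxx orbT.
have dKQ : {in X :|: Y, forall z, z \notin Q}.
  by move=> z /dP; rewrite defP !inE !negb_or => /and3P[].
have aKQ : a \notin X :|: Y :|: Q by rewrite inE negb_or aK.
have bKQ : b \notin X :|: Y :|: Q by rewrite inE negb_or bK.
have defV' : V = a |: (b |: (X :|: Y :|: Q)).
  rewrite defV defP; apply/setP=> z; rewrite !inE.
  by case: (z == a); case: (z == b); rewrite ?orbT.
have toB y : y \in Y -> adj E b y.
  exact: (@biclique_neighbour X Y Q a b k0 y).
have [y0 y0Y] : exists y, y \in Y by apply/card_gt0P; rewrite -cXY card_gt0.
(* The same argument with both pairs exchanged, starting from the edge [y0 b] just obtained. *)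
have toA x : x \in X -> adj E a x.
  apply: (@biclique_neighbour Y X Q b a y0 x) => //; rewrite 1?(setUC Y) //.
  - by move=> u v uY vX; rewrite adjC bXY.
  - by move=> z zY; apply: contraL zY; apply: dXY.
  - by rewrite defV'; apply/setP=> z; rewrite !inE orbCA.
  - by rewrite eq_sym.
  - by rewrite adjC toB.
move: aK bK; rewrite !inE !negb_or => /andP[aX aY] /andP[bX bY].
apply: (IH (b |: X) (a |: Y) Q) => //.
- by card_lia.
- move=> x y /setU1P[->|xX] /setU1P[->|yY].
  + by rewrite adjC.
  + exact: toB.
  + by rewrite adjC toA.
  + exact: bXY.
- by rewrite setU_eq0 -cards_eq0 cards1.
- by rewrite !cardsU1 aY bX cXY.
- move=> z /setU1P[->|zX]; rewrite inE negb_or inE.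
    by rewrite eq_sym nab.
  by rewrite dXY // andbT; apply: contraNneq aX => <-.
- move=> z; rewrite !inE -orbA => /or4P[/eqP->|zX|/eqP->|zY] //.
    by apply: dKQ; rewrite inE zX.
  by apply: dKQ; rewrite inE zY orbT.
- rewrite defV'; apply/setP=> z; rewrite !inE.
  by case: (z == a); case: (z == b); rewrite ?orbT.
Qed.

(** Take [x x'] and match the rest of [X] with [Y] minus [y], [y']. Only [y] and [y'] remain, so
    they are adjacent. *)
Lemma biclique_edge X Y x x' y y' : extendable E -> matchable E V ->
  {in X & Y, forall x y, adj E x y} -> #|X| = #|Y| ->
  {in X, forall z, z \notin Y} -> V = X :|: Y ->
  x \in X -> x' \in X -> adj E x x' -> y \in Y -> y' \in Y -> y != y' ->
  adj E y y'.
Proof.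
move=> ex mV bXY cXY dXY defV xX x'X xx' yY y'Y nyy'.
have nxx' := adj_neq gE xx'.
have mR : matchable E ((X :\ x :\ x') :|: (Y :\ y :\ y') :|: set0).
  apply: matchable_biclique; rewrite ?matchable0 //.
  - by move=> u v /setD1P[_ /setD1P[_ uX]] /setD1P[_ /setD1P[_ vY]]; apply: bXY.
  - have := cardsD1 x X; have := cardsD1 x' (X :\ x).
    have := cardsD1 y Y; have := cardsD1 y' (Y :\ y).
    by rewrite !inE xX x'X yY y'Y (eq_sym x') nxx' (eq_sym y') nyy'; card_lia.
  - by move=> z /setD1P[_ /setD1P[_ /dXY/negPf zY]]; rewrite !inE zY !andbF.
  - by move=> z _; rewrite inE.
rewrite setU0 in mR.
have xR : x \notin (X :\ x :\ x') :|: (Y :\ y :\ y').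
  by rewrite !inE eqxx (negPf (dXY _ xX)) !andbF.
have x'R : x' \notin (X :\ x :\ x') :|: (Y :\ y :\ y').
  by rewrite !inE eqxx (negPf (dXY _ x'X)) !andbF.
have mS := matchableU xx' xR x'R mR; set S := _ |: _ in mS.
have outS z : z \in V -> z \notin S -> z = y \/ z = y'.
  rewrite defV /S !inE.
  have [->|_] := eqVneq z y; first by left.
  have [->|_] := eqVneq z y'; first by right.
  by case: (z == x); case: (z == x'); case: (z \in X); case: (z \in Y).
have yX : y \notin X by apply: contraL yY; apply: dXY.
have yS : y \notin S.
  rewrite !inE eqxx (negPf yX) !andbF !orbF negb_or.
  by apply/andP; split; apply: contraNneq yX => ->.
have ltS : #|S| < #|V|.
  apply: proper_card; apply/properP; split; first exact: matchable_sub mS.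
  by exists y; rewrite // defV inE yY orbT.
have [p [q [pq pS qS]]] := ex _ _ mS mV ltS.
have [pV qV] := adj_in gE pq; have npq := adj_neq gE pq.
have [pe|pe] := outS p pV pS; have [qe|qe] := outS q qV qS; subst => //.
- by rewrite eqxx in npq.
- by rewrite adjC.
- by rewrite eqxx in npq.
Qed.

Lemma perfect_extendable : extendable E -> matchable E V ->
  complete V E \/ complete_bipartite V E.
Proof.
move=> ex mV; have [V0 _] := cE; have /set0Pn[x xV] := V0.
have [y [P [xy xP yP mP defV]]] := matchableD gE mV xV.
have nxy := adj_neq gE xy.
have [|||||||X [Y [bXY X0 cXY dXY defV']]] :=
    @biclique_grow [set x] [set y] P ex mV.
- by move=> u v; rewrite !inE => /eqP-> /eqP->.
- by rewrite -card_gt0 cards1.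
- by rewrite !cards1.
- by move=> z; rewrite !inE => /eqP->.
- by [].
- by move=> z; rewrite !inE => /orP[]/eqP->.
- by rewrite defV setUA.
have Y0 : Y != set0 by rewrite -card_gt0 -cXY card_gt0.
have dYX : {in Y, forall z, z \notin X}.
  by move=> z zY; apply: contraL zY; apply: dXY.
have bYX : {in Y & X, forall x y, adj E x y} by move=> u v uY vX; rewrite adjC bXY.
have defV2 : V = Y :|: X by rewrite setUC.
(* An edge inside [A] makes [B] a clique; [B] then has at least two vertices, so an edge inside [B]
   makes [A] a clique. *)
have full (A B : {set T}) u v : {in A & B, forall x y, adj E x y} -> #|A| = #|B| ->
    {in A, forall z, z \notin B} -> V = A :|: B ->
    u \in A -> v \in A -> adj E u v -> complete V E.
  move=> bAB cAB dAB dV uA vA uv.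
  have clB p q : p \in B -> q \in B -> p != q -> adj E p q.
    by move=> pB qB; apply: (@biclique_edge A B u v p q).
  have [p [q [pB qB npq]]] : exists p q, [/\ p \in B, q \in B & p != q].
    have : 1 < #|B|.
      rewrite -cAB (cardsD1 u) uA (cardsD1 v) !inE vA.
      by rewrite eq_sym (adj_neq gE uv).
    by move/card_gt1P=> [p [q []]]; exists p, q.
  have bBA : {in B & A, forall x y, adj E x y} by move=> c d cB dA; rewrite adjC bAB.
  have dBA : {in B, forall z, z \notin A}.
    by move=> z zB; apply: contraL zB; apply: dAB.
  have clA c d : c \in A -> d \in A -> c != d -> adj E c d.
    move=> cA dA; apply: (@biclique_edge B A p q c d) => //; last exact: clB.
    by rewrite setUC.
  apply: clique_complete => c d; rewrite dV !inE.
  by move=> /orP[] hc /orP[] hd ncd; auto.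
have [/existsP[u /existsP[v /and3P[uX vX uv]]]|noX] :=
    boolP [exists u, exists v, [&& u \in X, v \in X & adj E u v]].
  by left; apply: (full X Y u v).
have [/existsP[u /existsP[v /and3P[uX vX uv]]]|noY] :=
    boolP [exists u, exists v, [&& u \in Y, v \in Y & adj E u v]].
  by left; apply: (full Y X u v).
right; exists X, Y; split=> //.
  by apply/pred0P=> z /=; apply/negP=> /andP[/dXY/negP].
apply/setP=> f; apply/idP/imset2P => [fE|[u v uX vY ->]]; last exact: bXY.
have [u [v [-> uv uV vV _]]] := graph_edge gE fE.
move: uV vV; rewrite defV' !inE.
move=> /orP[hu|hu] /orP[hv|hv].
- by case/existsP: noX; exists u; apply/existsP; exists v; apply/and3P.
- by exists u v.
- by exists v u; rewrite // setUC.
- by case/existsP: noY; exists u; apply/existsP; exists v; apply/and3P.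
Qed.

(** * Independent missable vertices: they form one side of a bipartition *)

(** If every maximum set contained [c], exchanging edges around the path [w a c] would still produce
    one that misses [c]. *)
Lemma missable_neighbour w a c : extendable E ->
  {in missable &, forall x y, ~~ adj E x y} ->
  w \in missable -> adj E w a -> adj E a c -> c \in missable.
Proof.
move=> ex indep wD wa ac; apply/negPn/negP=> cD.
have [wV aV] := adj_in gE wa; have [_ cV] := adj_in gE ac.
have /(missableP wV)[S maxS wS] := wD.
have mS := maximum_matchable maxS.
have inD R z : matchable E R -> #|S| <= #|R| -> z \in V -> z \notin R -> z \in missable.
  by move=> mR leR zV zR; apply/(missableP zV); exists R; first exact: maximum_ge mR leR.
have aD : a \notin missable.
  by apply/negP=> aD; move/negP: (indep w a wD aD).
have aS : a \in S by apply: contraNT aD => aS; apply: (inD S).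
have [b [P [ab aP bP mP defS]]] := matchableD gE mS aS.
have [_ bV] := adj_in gE ab.
have nab := adj_neq gE ab; have nac := adj_neq gE ac; have nwa := adj_neq gE wa.
have cS : #|S| = #|P|.+2 by rewrite defS card_setU2.
move: wS; rewrite defS !inE !negb_or => /and3P[_ wb wP].
(* Replace [ab] by [wa]. *)
have bD : b \in missable.
  apply: (inD (w |: (a |: P))) => //; first exact: matchableU.
    by rewrite card_setU2 //; card_lia.
  by rewrite !inE !negb_or eq_sym wb eq_sym nab.
have cb : c != b by apply: contraNneq cD => ->.
have cP : c \in P.
  apply: contraNT cD => cP; apply: (inD S) => //.
  by rewrite defS !inE !negb_or eq_sym nac cb.
have [d [Q [cd cQ dQ mQ defP]]] := matchableD gE mP cP.
have ncd := adj_neq gE cd.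
have cardP : #|P| = #|Q|.+2 by rewrite defP card_setU2.
move: aP bP wP; rewrite defP !inE !negb_or.
move=> /and3P[_ ad aQ] /and3P[_ bd bQ] /and3P[wc wd wQ].
(* Trading [ab] and [cd] for [ac] covers two vertices fewer, so some edge [xy] lies outside the new
   set. *)
have mS2 := matchableU ac aQ cQ mQ.
have [|x [y [xy]]] := ex _ _ mS2 mS; first by rewrite card_setU2 //; card_lia.
rewrite !inE !negb_or => /and3P[xa xc xQ] /and3P[ya yc yQ].
have [xV yV] := adj_in gE xy.
(* Every vertex left over, apart from [d], is missable; independence then forces [d] to be an end of
   [xy]. *)
have zD z : z \in V -> z != a -> z != c -> z \notin Q -> z != d -> z \in missable.
  move=> zV za zc zQ zd; have [->//|zb] := eqVneq z b.
  by apply: (inD S) => //; rewrite defS defP !inE !negb_or za zb zc zd.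
wlog xd : x y xy xa xc xQ ya yc yQ xV yV / x = d => [hw|].
  have [xd|xd] := eqVneq x d; first exact: (hw x y).
  have [yd|yd] := eqVneq y d; first by apply: (hw y x); rewrite // adjC.
  by move/negP: (indep x y (zD x xV xa xc xQ xd) (zD y yV ya yc yQ yd)).
subst x; have dy := adj_neq gE xy.
have yd : y != d by rewrite eq_sym.
have yD := zD y yV ya yc yQ yd.
have dD : d \notin missable by apply/negP=> dD; move/negP: (indep d y dD yD).
have mB := matchableU xy dQ yQ mQ.
(* Both cases add four vertices to [Q], reaching the size of [S] without [c]: by [wa] and [db] if
   [y] is [b], by [ab] and [dy] otherwise. *)
have [yb|yb] := eqVneq y b.
  subst y.
  have wB : w \notin d |: (b |: Q) by rewrite !inE !negb_or wd wb.
  have aB : a \notin d |: (b |: Q) by rewrite !inE !negb_or ad nab.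
  case/negP: cD; apply: (inD (w |: (a |: (d |: (b |: Q))))) => //.
  - exact: matchableU.
  - by rewrite (card_setU2 wB aB nwa) (card_setU2 dQ bQ dy); card_lia.
  - by rewrite !inE !negb_or eq_sym wc eq_sym nac ncd cb.
have aB : a \notin d |: (y |: Q) by rewrite !inE !negb_or ad eq_sym ya.
have bB : b \notin d |: (y |: Q) by rewrite !inE !negb_or bd eq_sym yb.
case/negP: cD; apply: (inD (a |: (b |: (d |: (y |: Q))))) => //.
- exact: matchableU.
- by rewrite (card_setU2 aB bB nab) (card_setU2 dQ yQ dy); card_lia.
- by rewrite !inE !negb_or eq_sym nac cb ncd eq_sym yc.
Qed.

(** By connectedness [missable] and its neighbours exhaust [V]: no edge leaves their union, since a
    neighbour of a neighbour of [missable] is in [missable]. For the same reason no edge has both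
    ends outside [missable]. *)
Lemma missable_edge w : extendable E ->
  {in missable &, forall x y, ~~ adj E x y} -> w \in missable ->
  forall x y, adj E x y -> (x \in missable) = (y \notin missable).
Proof.
move=> ex indep wD.
pose K := missable :|: [set x in V | [exists z in missable, adj E z x]].
have KV : K = V.
  have sKV : K \subset V.
    by apply/subsetP=> x; rewrite !inE => /orP[] /andP[].
  have K0 : K != set0 by apply/set0Pn; exists w; rewrite inE wD.
  apply/eqP; apply/negPn/negP=> /(connected_cut gE cE K0 sKV)[x [y [xK yK xy]]].
  have [_ yV] := adj_in gE xy.
  have [xD|xD] := boolP (x \in missable).
    case/negP: yK; rewrite 2!inE inE yV; apply/orP; right.
    by apply/existsP; exists x; rewrite xD.
  move: xK; rewrite inE (negPf xD) inE => /andP[_ /existsP[z /andP[zD zx]]].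
  by case/negP: yK; rewrite inE (missable_neighbour ex indep zD zx xy).
move=> x y xy; have [xV yV] := adj_in gE xy.
have [xD|xD] := boolP (x \in missable); have [yD|yD] := boolP (y \in missable) => //.
  by move/negP: (indep x y xD yD).
move: xV; rewrite -KV inE (negPf xD) inE => /andP[_ /existsP[z /andP[zD zx]]].
by rewrite (missable_neighbour ex indep zD zx xy) in yD.
Qed.

End Grow.

(** * Edge-stable bipartite graphs *)

(** If the edge found outside [S] is [ad] itself, then [d] is not in [S]. Comparing [S] in $G-d$
    with a maximum set that misses [d] gives an edge avoiding [d], hence different from [ad]. *)
Lemma missable_extendable_del a d : extendable E -> extendable_avoiding E d ->
  d \in missable -> adj E a d -> extendable (E :\ [set a; d]).
Proof.
move=> ex exd dD ad S S' mS mS' ltS.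
have [aV dV] := adj_in gE ad.
have sub := subsetDl E [set [set a; d]].
have mSE := matchable_mono sub mS; have mSE' := matchable_mono sub mS'.
have [x [y [xy xS yS]]] := ex S S' mSE mSE' ltS.
have [def|ne] := eqVneq [set x; y] [set a; d]; last first.
  by exists x, y; rewrite /adj !inE ne.
have dS : d \notin S.
  have : d \in [set x; y] by rewrite def !inE eqxx orbT.
  by rewrite !inE => /orP[]/eqP->.
have /(missableP dV)[Sd maxSd dSd] := dD.
have [|p [q [pq pS qS pd qd]]] := exd S Sd mSE (maximum_matchable maxSd) dS dSd.
  exact: leq_trans ltS (maximum_le maxSd mSE').
exists p, q; split=> //; rewrite /adj !inE andbC [_ \in E]pq /=.
apply/eqP=> def'; have : d \in [set p; q] by rewrite def' !inE eqxx orbT.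
by rewrite !inE ![d == _]eq_sym (negPf pd) (negPf qd).
Qed.

Lemma matchable_bipartite_card (A S : {set T}) :
  (forall x y, adj E x y -> (x \in A) = (y \notin A)) ->
  matchable E S -> #|S :&: A| = #|S :\: A|.
Proof.
move=> bip; move: S; apply: (matchable_ind gE) => [|S x y _ xy nxy xS yS eqS].
  by rewrite set0I set0D.
wlog xA : x y xy nxy xS yS / x \in A => [hw|].
  have [xA|xA] := boolP (x \in A); first exact: hw.
  rewrite setUCA; apply: hw => //; rewrite 1?adjC 1?eq_sym //.
  by move: xA; rewrite (bip _ _ xy) negbK.
have yA : y \notin A by rewrite -(bip _ _ xy).
have -> : (x |: (y |: S)) :&: A = x |: (S :&: A).
  apply/setP=> z; rewrite !inE; have [->|_] := eqVneq z x; first by rewrite xA.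
  by have [->|_] := eqVneq z y; rewrite //= (negPf yA) andbF.
have -> : (x |: (y |: S)) :\: A = y |: (S :\: A).
  apply/setP=> z; rewrite !inE; have [->|_] := eqVneq z x.
    by rewrite xA (negPf nxy).
  by have [->|_] := eqVneq z y; rewrite //= yA.
by rewrite !cardsU1 !inE (negPf xS) (negPf yS) eqS andbF.
Qed.

(* The ambient set [W] makes the induction go through: it shrinks by the first
   edge of the alternating path from [u]. *)
Lemma bipartite_miss_both (A W : {set T}) S S' u v :
  (forall x y, adj E x y -> (x \in A) = (y \notin A)) ->
  matchable E S -> matchable E S' -> S \subset W -> S' \subset W ->
  #|S| = #|S'| ->
  (forall R, matchable E R -> R \subset W -> #|R| <= #|S|) ->
  u \in W -> u \in A -> v \notin A -> u \notin S -> v \notin S' ->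
  exists R, [/\ matchable E R, R \subset W, #|R| = #|S|, u \notin R & v \notin R].
Proof.
move=> bip; have [n] := ubnP #|S|; elim: n S S' W u => // n IH S S' W u.
move=> ltS mS mS' sSW sSW' eqS maxS uW uA vA uS vS'.
(* If [S'] covers [u], follow [u u1] from [S'] and then [u1 u2] from [S], which is back in [A].
   Induction at [u2] gives a set missing [u2] and [v], to which [u1 u2] is added; [u2] is not [v],
   since [v] is outside [A]. *)
have [uS'|uS'] := boolP (u \in S'); last by exists S'.
have [u1 [R' [uu1 uR' u1R' mR' defS']]] := matchableD gE mS' uS'.
have nu1 := adj_neq gE uu1.
have u1W : u1 \in W by apply: (subsetP sSW'); rewrite defS' !inE eqxx orbT.
have cS' : #|S'| = #|R'|.+2 by rewrite defS' card_setU2.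
have u1S : u1 \in S.
  apply: contraTT isT => u1S.
  have := maxS _ (matchableU uu1 uS u1S mS).
  rewrite !subUset !sub1set uW u1W sSW card_setU2 // => /(_ isT); card_lia.
have [u2 [R [u12 u1R u2R mR defS]]] := matchableD gE mS u1S.
have n12 := adj_neq gE u12.
have cS : #|S| = #|R|.+2 by rewrite defS card_setU2.
have /and3P[_ nu2 uR] : [&& u != u1, u != u2 & u \notin R].
  by move: uS; rewrite defS !inE !negb_or.
have u2A : u2 \in A by rewrite adjC in u12; rewrite (bip _ _ u12) -(bip _ _ uu1).
move: vS'; rewrite defS' !inE !negb_or => /and3P[vu vu1 vR'].
have subW' (B : {set T}) : B \subset W -> u \notin B -> u1 \notin B -> B \subset W :\ u :\ u1.
  by move=> sB uB u1B; rewrite !subsetD1 sB uB u1B.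
have sRW : R \subset W :\ u :\ u1.
  apply: subW' => //; apply: subset_trans sSW.
  by rewrite defS setUA subsetUr.
have sRW' : R' \subset W :\ u :\ u1.
  apply: subW' => //; apply: subset_trans sSW'.
  by rewrite defS' setUA subsetUr.
have u2W : u2 \in W :\ u :\ u1.
  rewrite !inE eq_sym n12 eq_sym nu2.
  by apply: (subsetP sSW); rewrite defS !inE eqxx orbT.
have maxR (B : {set T}) : matchable E B -> B \subset W :\ u :\ u1 -> #|B| <= #|R|.
  move=> mB; rewrite !subsetD1 => /andP[/andP[sB uB] u1B].
  have := maxS _ (matchableU uu1 uB u1B mB).
  by rewrite !subUset !sub1set uW u1W sB card_setU2 // cS => /(_ isT).
have ltR : #|R| < n by card_lia.
have eqR : #|R| = #|R'| by card_lia.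
have [Q [mQ]] := IH R R' _ u2 ltR mR mR' sRW sRW' eqR maxR u2W u2A vA u2R vR'.
rewrite !subsetD1 => /andP[/andP[sQ uQ] u1Q] cQ u2Q vQ.
have vu2 : v != u2 by apply: contraNneq vA => ->.
exists (u1 |: (u2 |: Q)); split.
- exact: matchableU.
- by rewrite !subUset !sub1set u1W sQ; move: u2W; rewrite !inE => /and3P[_ _ ->].
- by rewrite card_setU2 // cQ.
- by rewrite !inE !negb_or nu1 nu2.
- by rewrite !inE !negb_or vu1 vu2.
Qed.

(** Maximum sets missing [u] and [v] separately combine into one missing both, which is impossible
    when [uv] is an edge. *)
Lemma missable_bipartite_independent (A : {set T}) :
  (forall x y, adj E x y -> (x \in A) = (y \notin A)) ->
  {in missable &, forall x y, ~~ adj E x y}.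
Proof.
move=> bip u v uD vD; apply/negP=> uv.
wlog uA : u v uD vD uv / u \in A => [hw|].
  have [uA|uA] := boolP (u \in A); first exact: (hw u v).
  apply: (hw v u); rewrite 1?adjC //.
  by move: uA; rewrite (bip _ _ uv) negbK.
have [uV vV] := adj_in gE uv; have vA : v \notin A by rewrite -(bip _ _ uv).
have /(missableP uV)[S maxS uS] := uD; have /(missableP vV)[S' maxS' vS'] := vD.
have [mS mS'] := (maximum_matchable maxS, maximum_matchable maxS').
have eqS : #|S| = #|S'|.
  by apply/eqP; rewrite eqn_leq (maximum_le maxS mS') (maximum_le maxS' mS).
have [|R [mR _ cR uR vR]] := bipartite_miss_both bip mS mS' (subsetT S) (subsetT S')
    eqS _ (in_setT u) uA vA uS vS'.
  by move=> R mR _; apply: maximum_le.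
have maxR : maximum R by apply: (maximum_ge maxS mR); rewrite cR.
by move: uv; apply/negP; apply: maximum_independent maxR uR vR.
Qed.

(** Suppose every edge outside [S] meets [v], and let [vy] be one. Adding such an edge to [S] gives
    a maximum set, so [S'] is maximum too and [v] is missable. Deleting [vy] reveals another such
    edge [vz], and [S] with [vz] misses [y]. Then [v] and [y] are adjacent missable vertices. *)
Lemma bipartite_edge_stable_avoiding (A : {set T}) v :
  (forall x y, adj E x y -> (x \in A) = (y \notin A)) ->
  extendable E -> (forall f, f \in E -> extendable (E :\ f)) ->
  v \in V -> extendable_avoiding E v.
Proof.
move=> bip ex exD vV S S' mS mS' vS vS' ltS.
have [/existsP[x /existsP[y /and5P[]]]|no] := boolP [exists x, exists y,
    [&& adj E x y, x \notin S, y \notin S, x != v & y != v]].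
  by exists x, y.
have onlyv x y : adj E x y -> x \notin S -> y \notin S -> x = v \/ y = v.
  move=> xy xS yS; have [|xv] := eqVneq x v; first by left.
  have [|yv] := eqVneq y v; first by right.
  case/existsP: no; exists x; apply/existsP; exists y; exact/and5P.
have [y [vy yS]] : exists y, adj E v y /\ y \notin S.
  have [x [y [xy xS yS]]] := ex _ _ mS mS' ltS.
  have [xv|yv] := onlyv x y xy xS yS; first by exists y; rewrite -xv.
  by exists x; rewrite -yv adjC.
have maxvz z : adj E v z -> z \notin S -> maximum (v |: (z |: S)).
  move=> vz zS; have mvz := matchableU vz vS zS mS.
  rewrite /maximum mvz; apply/forallP=> R; apply/implyP=> mR.
  rewrite leqNgt; apply/negP=> /(ex _ _ mvz mR)[p [q [pq]]].
  rewrite !inE !negb_or => /and3P[pv _ pS] /and3P[qv _ qS].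
  by have [pe|qe] := onlyv p q pq pS qS; [rewrite pe eqxx in pv | rewrite qe eqxx in qv].
have maxS' : maximum S'.
  apply: (maximum_ge (maxvz y vy yS) mS').
  rewrite card_setU2 // ?(adj_neq gE vy) //.
  (* Both sizes are even, so [#|S'|] is at least [#|S| + 2]. *)
  have := matchable_even gE mS; have := matchable_even gE mS'.
  by card_lia.
have vD : v \in missable by apply/(missableP vV); exists S'.
(* Neither [S] nor [S'] contains [v], so both stay matchable without [vy]. *)
have [p [q [pq pS qS]]] :=
  exD _ vy _ _ (matchable_del_edge y mS vS) (matchable_del_edge y mS' vS') ltS.
have [z [vz zS zy]] : exists z, [/\ adj E v z, z \notin S & z != y].
  have /setD1P[ne pqE] : [set p; q] \in E :\ [set v; y] := pq.
  have {}pq : adj E p q := pqE.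
  have [pv|qv] := onlyv p q pq pS qS.
    by subst p; exists q; split=> //; apply: contraNneq ne => ->.
  subst q; exists p; split; rewrite 1?adjC //.
  by apply: contraNneq ne => ->; rewrite setUC.
have [_ yV] := adj_in gE vy.
have yD : y \in missable.
  apply/(missableP yV); exists (v |: (z |: S)); first exact: maxvz.
  by rewrite !inE !negb_or eq_sym (adj_neq gE vy) eq_sym zy.
by move/negP: (missable_bipartite_independent bip vD yD).
Qed.

(** * Complete and complete bipartite graphs *)

(** Covered sets have even size, so [S'] has at least two vertices outside [S], and any two vertices
    are adjacent. *)
Lemma complete_augmenting_edge S S' : complete V E ->
  matchable E S -> matchable E S' -> #|S| < #|S'| ->
  exists x y, [/\ adj E x y, x \notin S, y \notin S, x \in S' & y \in S'].
Proof.
move=> cplE mS mS' ltS.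
have : 1 < #|S' :\: S|.
  have := cardsID S S'; have := subset_leq_card (subsetIr S' S).
  have := matchable_even gE mS; have := matchable_even gE mS'; card_lia.
case/card_gt1P=> [x [y []]]; rewrite !inE => /andP[xS xS'] /andP[yS yS'] xy.
exists x, y; split=> //; rewrite /adj cplE; apply/imset2P; exists x y => //.
  exact: (subsetP (matchable_sub gE mS')).
by rewrite inE xy (subsetP (matchable_sub gE mS')).
Qed.

(** A covered set meets both sides equally often, so [S'] has a vertex outside [S] on each side. *)
Lemma biclique_augmenting_edge S S' : complete_bipartite V E ->
  matchable E S -> matchable E S' -> #|S| < #|S'| ->
  exists x y, [/\ adj E x y, x \notin S, y \notin S, x \in S' & y \in S'].
Proof.
move=> [A [B [_ _ dAB defV defE]]] mS mS' ltS.
have dBA z : z \in B -> z \notin A.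
  by apply: contraL => zA; move/pred0P/(_ z): dAB; rewrite /= zA => /= ->.
have bip x y : adj E x y -> (x \in A) = (y \notin A).
  rewrite /adj defE => /imset2P[a b aA bB] eqab.
  have xab : x \in [set a; b] by rewrite -eqab !inE eqxx.
  have yab : y \in [set a; b] by rewrite -eqab !inE eqxx orbT.
  have nxy : x != y by apply: (@adj_neq _ V E); rewrite // /adj eqab defE; apply/imset2P; exists a b.
  move: xab yab nxy; rewrite !inE => /orP[]/eqP-> /orP[]/eqP->; rewrite ?eqxx //.
    by rewrite aA dBA.
  by rewrite aA (negPf (dBA _ bB)).
have eS := matchable_bipartite_card bip mS; have eS' := matchable_bipartite_card bip mS'.
have cS := cardsID A S; have cS' := cardsID A S'.
have pick (C D : {set T}) : #|C| < #|D| -> exists2 z, z \in D & z \notin C.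
  by move=> ltCD; apply/subsetPn; apply: contraL ltCD => /subset_leq_card; rewrite -leqNgt.
have [|x /setIP[xS' xA] xS] := pick (S :&: A) (S' :&: A); first by card_lia.
have [|y /setDP[yS' yA] yS] := pick (S :\: A) (S' :\: A); first by card_lia.
rewrite inE xA andbT in xS; rewrite inE yA in yS.
exists x, y; split=> //; rewrite /adj defE; apply/imset2P; exists x y => //.
by have := subsetP (matchable_sub gE mS') y yS'; rewrite defV inE (negPf yA).
Qed.

Lemma bipartiteP : bipartite V E <-> exists2 A : {set T}, A \subset V &
  forall x y, adj E x y -> (x \in A) = (y \notin A).
Proof.
have one (A : {set T}) x y : x != y -> (#|[set x; y] :&: A| == 1) = ((x \in A) == (y \notin A)).
  move=> nxy; have -> : #|[set x; y] :&: A| = (x \in A) + (y \in A).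
    rewrite setIC -(cardsID [set x]) (_ : _ :&: [set x; y] :&: _ = A :&: [set x]).
      rewrite (_ : _ :\: _ = A :&: [set y]).
        have c1 z : #|A :&: [set z]| = (z \in A).
          have [zA|zA] := boolP (z \in A).
            by rewrite (setIidPr _) ?cards1 // sub1set.
          by apply/eqP; rewrite cards_eq0 setI_eq0 disjoint_sym disjoints1.
        by rewrite !c1.
      apply/setP=> z; rewrite !inE; have [->|_] := eqVneq z y; rewrite ?orbT ?andbT.
        by rewrite eq_sym nxy.
      by rewrite orbF; case: (z == x); rewrite ?andbF.
    by apply/setP=> z; rewrite !inE; case: (z == x); rewrite ?andbF ?andbT.
  by case: (x \in A); case: (y \in A).
split=> [[A [sAV bip]]|[A sAV bip]]; exists A => //.
  by move=> x y xy; apply/eqP; rewrite -one ?(adj_neq gE xy) //; apply/eqP/bip.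
split=> // f fE; have [x [y [-> xy _ _ nxy]]] := graph_edge gE fE.
by apply/eqP; rewrite one // (bip x y xy).
Qed.

End Maximum.

(** * Assembly of both directions, by the shape of the missable set *)

Theorem theorem7p6 (T : finType) (V : {set T}) (E : {set {set T}}) :
  is_graph V E -> connected V E ->
  (vertex_stable_equimatchable V E <->
     complete V E \/ complete_bipartite V E \/
     (bipartite V E /\ edge_stable_equimatchable V E)).
Proof.
move=> gE cE; rewrite (vertex_stableP gE) (edge_stableP gE) (bipartiteP gE).
split=> [[ex exV]|].
  have [/existsP[u /existsP[v /and3P[uD vD uv]]]|noD] := boolP [exists u, exists v,
      [&& u \in missable V E, v \in missable V E & adj E u v]].
    by left; apply: (missable_edge_complete gE cE exV uD vD uv).
  have indep : {in missable V E &, forall x y, ~~ adj E x y}.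
    move=> x y xD yD; apply: contra noD => xy.
    by apply/existsP; exists x; apply/existsP; exists y; apply/and3P.
  have [D0|[w wD]] := set_0Vmem (missable V E).
    have [S maxS] := maximum_exists E; have mS := maximum_matchable maxS.
    have SV : S = V.
      apply/eqP; rewrite eqEsubset (matchable_sub gE mS); apply/subsetP=> x xV.
      apply: contraT => xS; have : x \in missable V E by apply/(missableP _ xV); exists S.
      by rewrite D0 inE.
    by rewrite SV in mS; case: (perfect_extendable gE cE ex mS); [left | right; left].
  have bip := missable_edge gE cE ex indep wD.
  right; right; split.
    exists (V :\: missable V E); first exact: subsetDl.
    move=> x y xy; have [xV yV] := adj_in gE xy.
    by rewrite !in_setD xV yV !andbT (bip _ _ xy).
  split=> // f fE; have [x [y [-> xy xV yV _]]] := graph_edge gE fE.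
  have [yD|yD] := boolP (y \in missable V E).
    by apply: (missable_extendable_del gE ex (exV y yV) yD xy).
  have xD : x \in missable V E by rewrite (bip _ _ xy).
  by rewrite setUC; apply: (missable_extendable_del gE ex (exV x xV) xD); rewrite adjC.
(* An edge with both ends in [S'] avoids every [v] outside [S'], so one property serves $G$ and all
   $G-v$. *)
have strong : (forall S S', matchable E S -> matchable E S' -> #|S| < #|S'| ->
    exists x y, [/\ adj E x y, x \notin S, y \notin S, x \in S' & y \in S']) ->
    extendable E /\ {in V, forall v, extendable_avoiding E v}.
  move=> st; split=> [S S' mS mS' lt|v _ S S' mS mS' vS vS' lt].
    by have [x [y [xy xS yS _ _]]] := st S S' mS mS' lt; exists x, y.
  have [x [y [xy xS yS xS' yS']]] := st S S' mS mS' lt; exists x, y.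
  by split=> //; apply: contraNneq vS' => <-.
case=> [cplE|[cbE|[[A _ bip] [ex exD]]]].
- by apply: strong => S S'; apply: complete_augmenting_edge cplE.
- by apply: strong => S S'; apply: biclique_augmenting_edge cbE.
- by split=> // v vV; apply: (bipartite_edge_stable_avoiding gE bip ex exD vV).
Qed.
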